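(* Let $g=g(z)=p(z)/q(z)$ for some polynomials $p(z)$ and $q(z)$ with real coefficients such that $p(0)=1$ and $q(0)=1$. Let $f\ne -z$ be the pseudo-involutory companion of $g$. Write $p(z)=\sum_{n\ge0}c_nz^n$ and $q(z)=\sum_{n\ge0}d_nz^n$, where only finitely many of the $c_n$ and $d_n$ are nonzero. Then the B-function $B_f$ of $f$ is a power series solution of the bivariate polynomial equation $$\sum_{n,k\ge0}(-1)^n\left(c_nc_{n+k}-d_nd_{n+k}\right)z^{n+\frac k2}R_k\left(-\sqrt z\,B_f\right)=0.$$
   Context: A Riordan array is a pair $(g,f)$ of power series in $\mathbb{R}[[z]]$ with $g$ of order $0$ and $f$ of order $1$, multiplied by $(g,f)(G,F)=(g\cdot(G\circ f),F\circ f)$; it is a pseudo-involution if $(g,-f)^2=(1,z)$, equivalently $g\circ(-f)=1/g$ and $-f$ is a compositional involution. When $(g,f)$ is a pseudo-involution, $f$ is called the pseudo-involutory companion of $g$ (its existence is assumed). The B-function $B_f\in\mathbb{R}[[z]]$ of $f$ is defined by $f-z=zf\,B_f(zf)$. The polynomials $R_k$ are defined as follows. Let $T_n,U_n$ be the Chebyshev polynomials of the first and second kind ($T_n(\cos\theta)=\cos n\theta$, $U_n(\cos\theta)=\frac{\sin((n+1)\theta)}{\sin\theta}$, $U_{-1}=0$). Put $P_n(z)=U_n\left(\tfrac{z+2}{2}\right)+U_{n-1}\left(\tfrac{z+2}{2}\right)$ for $n\ge0$, $Q_0(z)=1$, and $Q_n(z)=2T_n\left(\tfrac{z+2}{2}\right)$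 for $n\ge1$. Then $R_{2n}(z)=Q_n(z^2)$ and $R_{2n+1}(z)=zP_n(z^2)$ for $n\ge0$. Equivalently, $R_0=1$ and $R_n\left(\frac{u^2-v^2}{uv}\right)=\frac{(u^2)^n+(-v^2)^n}{(uv)^n}$ for $n\ge1$. Since $R_k$ has the same parity as $k$, each $z^{k/2}R_k(-\sqrt z\,y)$ is a polynomial in $z$ and $y$. *)

(* Defs.v *)
From HB Require Import structures.
From mathcomp Require Import all_boot all_order all_algebra.
From mathcomp Require Import boolp reals trigo.
From mathcomp Require Import ring.

Set Implicit Arguments.
Unset Strict Implicit.
Unset Printing Implicit Defensive.

Import Order.TTheory GRing.Theory Num.Theory.
Local Open Scope ring_scope.

(* Formal power series as coefficient sequences, wrapped in a record so that the
   Cauchy product does not compete with the pointwise product on nat -> K. *)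
Record fps (K : Type) := FPS { fcoef : nat -> K }.

HB.instance Definition _ (K : Type) := gen_eqMixin (fps K).
HB.instance Definition _ (K : Type) := gen_choiceMixin (fps K).

Lemma fpsP (K : Type) (a b : fps K) : (forall n, fcoef a n = fcoef b n) -> a = b.
Proof.
by case: a b => [a] [b] /= eq_ab; congr FPS; apply/funext.
Qed.

Section FpsRing.
Variable K : comNzRingType.
Implicit Types a b c : fps K.

Definition fps_zero : fps K := FPS (fun _ => 0).
Definition fps_one : fps K := FPS (fun n => (n == 0%N)%:R).
Definition fps_opp a : fps K := FPS (fun n => - fcoef a n).
Definition fps_add a b : fps K := FPS (fun n => fcoef a n + fcoef b n).
Definition fps_mul a b : fps K :=
  FPS (fun n => \sum_(i < n.+1) fcoef a i * fcoef b (n - i)).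

Fact fps_addA : associative fps_add.
Proof. by move=> a b c; apply: fpsP => n /=; rewrite addrA. Qed.
Fact fps_addC : commutative fps_add.
Proof. by move=> a b; apply: fpsP => n /=; rewrite addrC. Qed.
Fact fps_add0 : left_id fps_zero fps_add.
Proof. by move=> a; apply: fpsP => n /=; rewrite add0r. Qed.
Fact fps_addN : left_inverse fps_zero fps_opp fps_add.
Proof. by move=> a; apply: fpsP => n /=; rewrite addNr. Qed.

HB.instance Definition _ :=
  GRing.isZmodule.Build (fps K) fps_addA fps_addC fps_add0 fps_addN.

Definition fps_trunc n a : {poly K} := \poly_(i < n.+1) fcoef a i.

Lemma coef_trunc n a i : (i <= n)%N -> (fps_trunc n a)`_i = fcoef a i.
Proof. by move=> le_in; rewrite coef_poly ltnS le_in. Qed.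

Lemma fcoef_mul_trunc n a b i : (i <= n)%N ->
  fcoef (fps_mul a b) i = (fps_trunc n a * fps_trunc n b)`_i.
Proof.
move=> le_in; rewrite coefM /=; apply: eq_bigr => j _.
rewrite !coef_trunc //; first by rewrite (leq_trans (leq_subr _ _)).
by rewrite (leq_trans _ le_in) // -ltnS.
Qed.

Fact fps_mulA : associative fps_mul.
Proof.
move=> a b c; apply: fpsP => n.
transitivity ((fps_trunc n a * (fps_trunc n b * fps_trunc n c))`_n).
  rewrite coefM /=; apply: eq_bigr => j _.
  by rewrite coef_trunc -1?ltnS // -(@fcoef_mul_trunc n) // leq_subr.
rewrite mulrA coefM /=; apply: eq_bigr => j _.
by rewrite coef_trunc ?leq_subr // -(@fcoef_mul_trunc n) // -ltnS.
Qed.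

Fact fps_mulC : commutative fps_mul.
Proof.
move=> a b; apply: fpsP => n.
by rewrite !(@fcoef_mul_trunc n) // mulrC.
Qed.

Fact fps_mul1 : left_id fps_one fps_mul.
Proof.
move=> a; apply: fpsP => n /=.
rewrite big_ord_recl /= mul1r subn0 big1 ?addr0 // => i _.
by rewrite mul0r.
Qed.

Fact fps_mulD : left_distributive fps_mul fps_add.
Proof.
move=> a b c; apply: fpsP => n /=.
by rewrite -big_split; apply: eq_bigr => i _; rewrite mulrDl.
Qed.

Fact fps_one_neq0 : fps_one != fps_zero.
Proof.
by apply/eqP => /(congr1 (fun a => fcoef a 0)) /= /eqP; rewrite oner_eq0.
Qed.

HB.instance Definition _ := GRing.Zmodule_isComNzRing.Build (fps K)
  fps_mulA fps_mulC fps_mul1 fps_mulD fps_one_neq0.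

Lemma fcoef0 n : fcoef (0 : fps K) n = 0. Proof. by []. Qed.
Lemma fcoef1 n : fcoef (1 : fps K) n = (n == 0%N)%:R. Proof. by []. Qed.
Lemma fcoefN a n : fcoef (- a) n = - fcoef a n. Proof. by []. Qed.
Lemma fcoefD a b n : fcoef (a + b) n = fcoef a n + fcoef b n. Proof. by []. Qed.
Lemma fcoefB a b n : fcoef (a - b) n = fcoef a n - fcoef b n. Proof. by []. Qed.
Lemma fcoefM a b n :
  fcoef (a * b) n = \sum_(i < n.+1) fcoef a i * fcoef b (n - i).
Proof. by []. Qed.
Lemma fcoef_sum I (r : seq I) (P : pred I) (F : I -> fps K) n :
  fcoef (\sum_(i <- r | P i) F i) n = \sum_(i <- r | P i) fcoef (F i) n.
Proof. by elim/big_rec2: _ => // i x y _ <-. Qed.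

Lemma fcoefX_small a k n : fcoef a 0 = 0 -> (n < k)%N -> fcoef (a ^+ k) n = 0.
Proof.
move=> a0; elim: k n => // k IHk n lt_nk; rewrite exprS fcoefM big1 // => i _.
case: (posnP i) => [-> | i_gt0]; first by rewrite a0 mul0r.
rewrite IHk ?mulr0 // ltn_subLR; last by rewrite -ltnS.
by rewrite (leq_trans lt_nk) // -add1n leq_add2r.
Qed.

Definition fps_of_poly (p : {poly K}) : fps K := FPS (fun n => p`_n).

Fact fps_of_poly_zmod : zmod_morphism fps_of_poly.
Proof. by move=> p q; apply: fpsP => n; rewrite fcoefB /= coefB. Qed.

Fact fps_of_poly_monoid : monoid_morphism fps_of_poly.
Proof.
split; first by apply: fpsP => n; rewrite fcoef1 /= coef1.
by move=> p q; apply: fpsP => n; rewrite fcoefM /= coefM.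
Qed.

HB.instance Definition _ := GRing.isZmodMorphism.Build
  {poly K} (fps K) fps_of_poly fps_of_poly_zmod.
HB.instance Definition _ := GRing.isMonoidMorphism.Build
  {poly K} (fps K) fps_of_poly fps_of_poly_monoid.

Definition fpsX : fps K := fps_of_poly 'X.

(* a \o b; meaningful when b has no constant term, in which case only the
   powers b ^+ k with k <= n contribute to the coefficient of degree n. *)
Definition fps_comp a b : fps K :=
  FPS (fun n => \sum_(k < n.+1) fcoef a k * fcoef (b ^+ k) n).

End FpsRing.

Section FpsUnit.
Variable K : comUnitRingType.
Implicit Types a b : fps K.

Definition fps_unit : {pred fps K} := [pred a | fcoef a 0 \is a GRing.unit].

(* With c = a_0^-1, the inverse of a is c times the geometric series in
   1 - c a, which has no constant term. *)
Definition fps_inv a : fps K :=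
  if a \in fps_unit then
    let c : fps K := fps_of_poly (fcoef a 0)^-1%:P in
    FPS (fun n => fcoef (c * \sum_(k < n.+1) (1 - c * a) ^+ k) n)
  else a.

Fact fps_mulV : {in fps_unit, left_inverse 1 fps_inv *%R}.
Proof.
move=> a Ua; rewrite /fps_inv Ua; set c := fps_of_poly _.
set h := 1 - c * a; apply: fpsP => n.
have h0 : fcoef h 0 = 0.
  by rewrite fcoefB fcoefM big_ord1 /= coefC mulVr ?subrr.
pose s := \sum_(k < n.+1) h ^+ k.
have sE m : (m <= n)%N ->
    fcoef (c * \sum_(k < m.+1) h ^+ k) m = fcoef (c * s) m.
  move=> le_mn; rewrite !fcoefM; apply: eq_bigr => i _; congr (_ * _).
  rewrite !fcoef_sum /= [RHS](bigID (fun k : 'I_n.+1 => (k < m.+1)%N)) /=.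
  rewrite [X in _ + X]big1 ?addr0; last first.
    move=> k; rewrite -leqNgt => lt_mk; apply: fcoefX_small => //.
    by rewrite (leq_trans _ lt_mk) // ltnS leq_subr.
  by rewrite (big_ord_widen n.+1 (fun k => fcoef (h ^+ k) (m - i))).
transitivity (fcoef (c * s * a) n).
  rewrite !fcoefM; apply: eq_bigr => i _; congr (_ * _).
  by rewrite /= -[LHS]/(fcoef (c * \sum_(k < i.+1) h ^+ k) i) sE // -ltnS.
have -> : c * s * a = 1 - h ^+ n.+1.
  have -> : c * s * a = (1 - h) * s by rewrite /h subKr mulrAC.
  by rewrite -[1 in RHS](expr1n _ n.+1) subrXX; congr (_ * _);
     apply: eq_bigr => k _; rewrite expr1n mul1r.
by rewrite fcoefB fcoefX_small ?subr0.
Qed.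

Fact fps_unitPl a b : b * a = 1 -> fps_unit a.
Proof.
move=> /(congr1 (fun x => fcoef x 0)); rewrite fcoefM big_ord1 fcoef1 /= => ba1.
by apply/unitrP; exists (fcoef b 0); rewrite [fcoef a 0 * _]mulrC.
Qed.

Fact fps_inv_out : {in [predC fps_unit], fps_inv =1 id}.
Proof. by move=> a; rewrite inE /fps_inv => /negPf ->. Qed.

HB.instance Definition _ := GRing.ComNzRing_hasMulInverse.Build (fps K)
  fps_mulV fps_unitPl fps_inv_out.

End FpsUnit.

Section Riordan.
Variable R : realType.
Implicit Types (f g B : fps R) (A : fps R * fps R).

Definition is_riordan A : Prop :=
  [/\ fcoef A.1 0 != 0, fcoef A.2 0 = 0 & fcoef A.2 1 != 0].

Definition riordan_mul A A' : fps R * fps R :=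
  (A.1 * fps_comp A'.1 A.2, fps_comp A'.2 A.2).

Definition is_pseudo_involution A : Prop :=
  is_riordan A /\ riordan_mul (A.1, - A.2) (A.1, - A.2) = (1, fpsX R).

Definition pseudo_involutory_companion g f : Prop := is_pseudo_involution (g, f).

(* z * f has order 2 and f - z = (z * f) * (B \o (z * f)) has at most one
   solution B; hence the B-function is given here by its defining equation. *)
Definition is_B_function f B : Prop :=
  f - fpsX R = fpsX R * f * fps_comp B (fpsX R * f).

End Riordan.

Section Polynomials.
Variable R : realType.

Fixpoint chebT_pair n : {poly R} * {poly R} :=
  if n is m.+1 then
    let: (a, b) := chebT_pair m in (b, 2 *: 'X * b - a)
  else (1, 'X).

Definition chebT n : {poly R} := (chebT_pair n).1.

Fixpoint chebU_pair n : {poly R} * {poly R} :=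
  if n is m.+1 then
    let: (a, b) := chebU_pair m in (b, 2 *: 'X * b - a)
  else (0, 1).

(* The first component of chebU_pair n is U_(n-1), with U_(-1) = 0. *)
Definition chebU_pred n : {poly R} := (chebU_pair n).1.
Definition chebU n : {poly R} := chebU_pred n.+1.

Lemma chebTSS n : chebT n.+2 = 2 *: 'X * chebT n.+1 - chebT n.
Proof. by rewrite /chebT /=; case: (chebT_pair n). Qed.

Lemma chebU_predSS n :
  chebU_pred n.+2 = 2 *: 'X * chebU_pred n.+1 - chebU_pred n.
Proof. by rewrite /chebU_pred /=; case: (chebU_pair n). Qed.

Lemma chebT_cos n (t : R) : (chebT n).[cos t] = cos (n%:R * t).
Proof.
suff [] : (chebT n).[cos t] = cos (n%:R * t) /\
          (chebT n.+1).[cos t] = cos (n.+1%:R * t) by [].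
elim: n => [|n [IHn IHn1]]; first by rewrite /chebT /= hornerC hornerX mul0r cos0 mul1r.
split=> //; rewrite chebTSS !hornerE /= IHn IHn1.
have -> : n.+2%:R * t = n.+1%:R * t + t by rewrite [in LHS]mulrSr mulrDl mul1r.
have -> : n%:R * t = n.+1%:R * t - t by rewrite mulrSr mulrDl mul1r addrK.
by rewrite cosB cosD; ring.
Qed.

Lemma chebU_pred_sin n (t : R) : (chebU_pred n).[cos t] * sin t = sin (n%:R * t).
Proof.
suff [] : (chebU_pred n).[cos t] * sin t = sin (n%:R * t) /\
          (chebU_pred n.+1).[cos t] * sin t = sin (n.+1%:R * t) by [].
elim: n => [|n [IHn IHn1]].
  by rewrite /chebU_pred /= hornerC hornerC !mul0r sin0 !mul1r.
split=> //; rewrite chebU_predSS !hornerE /= mulrBl IHn -[X in X - _]mulrA IHn1.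
have -> : n.+2%:R * t = n.+1%:R * t + t by rewrite [in LHS]mulrSr mulrDl mul1r.
have -> : n%:R * t = n.+1%:R * t - t by rewrite mulrSr mulrDl mul1r addrK.
by rewrite sinB sinD; ring.
Qed.

Lemma chebU_sin n (t : R) : (chebU n).[cos t] * sin t = sin (n.+1%:R * t).
Proof. exact: chebU_pred_sin. Qed.

Definition half_shift : {poly R} := 2^-1 *: ('X + 2%:P).

Definition polyP n : {poly R} :=
  (chebU n \Po half_shift) + (chebU_pred n \Po half_shift).

Definition polyQ n : {poly R} :=
  if n is 0 then 1 else 2 *: (chebT n \Po half_shift).

Definition polyR k : {poly R} :=
  if odd k then 'X * (polyP k./2 \Po 'X^2) else polyQ k./2 \Po 'X^2.

Lemma polyR_parity k j : odd k != odd j -> (polyR k)`_j = 0.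
Proof.
rewrite /polyR; case: (odd k) => odd_j; rewrite 1?mulrC ?coefMX.
  by case: j odd_j => //= j; rewrite comp_poly_Xn // coef_poly;
     case: ifP => // _; rewrite dvdn2; case: odd.
rewrite comp_poly_Xn // coef_poly; case: ifP => // _.
by rewrite dvdn2; case: odd odd_j.
Qed.

(* z^(k/2) R_k(- sqrt z y) as a polynomial in y (outer variable) whose
   coefficients are polynomials in z (inner variable): the monomial x^j of R_k
   contributes (- y)^j z^((k + j) / 2), where k + j is even. *)
Definition half_polyR k : {poly {poly R}} :=
  \sum_(j < size (polyR k))
    ((polyR k)`_j *: 'X^((k + j)./2)) *: (- 'X) ^+ j.

(* Writing z = s^2, half_polyR k becomes s^k R_k(- s y). *)
Lemma half_polyR_sqr k :
  map_poly (comp_poly 'X^2) (half_polyR k) =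
  'X^k *: (map_poly polyC (polyR k) \Po (- ('X *: 'X))).
Proof.
rewrite /half_polyR rmorph_sum /= comp_polyE size_map_polyC scaler_sumr.
apply: eq_bigr => j _; rewrite map_polyZ /= rmorphXn rmorphN /= map_polyX.
rewrite coef_map /= comp_polyZ comp_Xn_poly -exprM.
have [->|nz_j] := eqVneq (polyR k)`_j 0; first by rewrite !scale0r scaler0.
have ev : (2 * (k + j)./2 = k + j)%N.
  rewrite mul2n even_halfK // oddD; apply: contraNN nz_j => odd_kj.
  by rewrite polyR_parity //; case: odd odd_kj; case: odd.
rewrite ev -scalerN exprZn !scalerA ['X^k * _]mulrC mul_polyC.
by rewrite -scalerAl exprD.
Qed.

(* The sum over n, k is finite: every term with n or n + k at least
   maxn (size p) (size q) vanishes. *)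
Definition Bfun_poly (p q : {poly R}) : {poly {poly R}} :=
  let N := maxn (size p) (size q) in
  \sum_(n < N) \sum_(k < N)
    ((-1) ^+ n * (p`_n * p`_(n + k) - q`_n * q`_(n + k)) *: 'X^n)
      *: half_polyR k.

(* F is a polynomial in y over polynomials in z; z is sent to the power
   series variable and y to B. *)
Definition is_series_solution (F : {poly {poly R}}) (B : fps R) : Prop :=
  (map_poly (@fps_of_poly R) F).[B] = 0.

End Polynomials.

(* Main.v *)
Require Import Defs.
From HB Require Import structures.
From mathcomp Require Import all_boot all_order all_algebra.
From mathcomp Require Import boolp reals trigo.
From mathcomp Require Import ring.

Import Order.TTheory GRing.Theory Num.Theory.
Local Open Scope ring_scope.

(** Put [h = - f] and [t = z * f].  Since [g] composed with [h] is [1 / g], one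
    has [p(z) p(h) = q(z) q(h)].  Expanding and grouping the monomials
    [z^i h^j] by [n = min i j] and [k = |i - j|] gives the terms
    [(z h)^n (z^k + h^k)], where [z h = - t] and [z + h = - t B(t)].  The
    Lucas-type recurrence of the [R_k] identifies [z^k + h^k] with
    [t^(k/2) R_k (- sqrt t B(t))], so the polynomial equation holds at
    [(t, B(t))].  As [t] has order 2, composition with [t] is injective on
    power series, and the equation holds at [(z, B)]. *)

(** * Composition of power series: multiplicativity and orders *)

Section Composition.
Context {K : comNzRingType}.
Implicit Types (a b c : fps K) (P : {poly K}).

Lemma fcoefCM x b n : fcoef (fps_of_poly x%:P * b) n = x * fcoef b n.
Proof.
rewrite fcoefM big_ord_recl /= coefC subn0 big1 ?addr0 // => i _.
by rewrite coefC mul0r.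
Qed.

(** Since [b ^+ k] has order at least [k], cutting the sum at degree [n] loses nothing, and
    composition becomes Horner evaluation. *)
Lemma fps_comp_poly P b : fcoef b 0 = 0 ->
  fps_comp (fps_of_poly P) b = (map_poly (@fps_of_poly K \o polyC) P).[b].
Proof.
move=> b0; apply: fpsP => n.
(* The range [n.+1 + size P] covers both the support of [P] and the indices used by [fps_comp] in
   degree [n]. *)
have -> : (map_poly (@fps_of_poly K \o polyC) P).[b] =
    \sum_(k < n.+1 + size P) fps_of_poly (P`_k)%:P * b ^+ k.
  rewrite (@horner_coef_wide _ (n.+1 + size P)); last first.
    by rewrite (leq_trans (size_poly _ _)) ?leq_addl.
  by apply: eq_bigr => k _; rewrite coef_map.
rewrite fcoef_sum; under eq_bigr do rewrite fcoefCM.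
rewrite big_split_ord /= [X in _ + X]big1 ?addr0 // => k _.
by rewrite fcoefX_small ?mulr0 // addSn ltnS leq_addr.
Qed.

Lemma fps_comp_eq a a' b n : (forall k, (k <= n)%N -> fcoef a k = fcoef a' k) ->
  fcoef (fps_comp a b) n = fcoef (fps_comp a' b) n.
Proof. by move=> eq_a; apply: eq_bigr => k _; rewrite eq_a // -ltnS. Qed.

Lemma fps_compB a a' b : fps_comp (a - a') b = fps_comp a b - fps_comp a' b.
Proof.
apply: fpsP => n; rewrite fcoefB -sumrB; apply: eq_bigr => k _.
by rewrite fcoefB mulrBl.
Qed.

(** Degree [n] only sees the truncations of [a] and [a'] at [n], and for polynomials evaluation is
    multiplicative. *)
Lemma fps_compM a a' b : fcoef b 0 = 0 ->
  fps_comp (a * a') b = fps_comp a b * fps_comp a' b.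
Proof.
move=> b0; apply: fpsP => n.
have trE (c : fps K) (k : nat) : (k <= n)%N ->
    fcoef (fps_of_poly (fps_trunc n c)) k = fcoef c k.
  by move=> le_kn; rewrite /= coef_trunc.
transitivity
    (fcoef (fps_comp (fps_of_poly (fps_trunc n a * fps_trunc n a')) b) n).
  by apply: fps_comp_eq => k le_kn; apply: fcoef_mul_trunc.
rewrite fps_comp_poly // rmorphM hornerM -!fps_comp_poly // !fcoefM.
apply: eq_bigr => i _; congr (_ * _); apply: fps_comp_eq => k le_k; apply: trE.
  by rewrite (leq_trans le_k) // -ltnS.
by rewrite (leq_trans le_k) // leq_subr.
Qed.

Lemma fps_comp1 b : fps_comp 1 b = 1.
Proof.
apply: fpsP => n /=; rewrite big_ord_recl mul1r expr0 big1 ?addr0 // => i _.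
by rewrite mul0r.
Qed.

Lemma fps_compX b : fcoef b 0 = 0 -> fps_comp (fpsX K) b = b.
Proof. by move=> b0; rewrite fps_comp_poly // map_polyX hornerX. Qed.

Lemma fps_compC x b : fcoef b 0 = 0 ->
  fps_comp (fps_of_poly x%:P) b = fps_of_poly x%:P.
Proof. by move=> b0; rewrite fps_comp_poly // map_polyC hornerC. Qed.

Lemma fcoefX_order b m k : (forall i, (i < m)%N -> fcoef b i = 0) ->
  (forall i, (i < m * k)%N -> fcoef (b ^+ k) i = 0) /\
  fcoef (b ^+ k) (m * k) = fcoef b m ^+ k.
Proof.
move=> b_small; elim: k => [|k [IHs IHe]]; first by rewrite muln0.
split=> [i lt_i|].
  rewrite exprS fcoefM big1 // => j _.
  have [lt_jm|le_mj] := ltnP j m; first by rewrite b_small ?mul0r.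
  rewrite IHs ?mulr0 // ltn_subLR; last by rewrite -ltnS.
  by rewrite (leq_trans lt_i) // mulnS leq_add2r.
have lt_m : (m < (m * k.+1).+1)%N by rewrite ltnS mulnS leq_addr.
rewrite exprS fcoefM (bigD1 (Ordinal lt_m)) //= {1}mulnS addKn IHe -exprS.
rewrite big1 ?addr0 // => j ne_jm.
have [lt_jm|le_mj] := ltnP j m; first by rewrite b_small ?mul0r.
rewrite IHs ?mulr0 // ltn_subLR; last by rewrite -ltnS.
by rewrite [ltnLHS]mulnS ltn_add2r ltn_neqAle le_mj andbT eq_sym.
Qed.

End Composition.

(** Strong induction on [n]: in degree [m * n] the terms below [n] vanish by induction and those
    above by their order, which leaves [a_n b_m^n = 0]. *)
Lemma fps_comp_eq0 (K : idomainType) (a b : fps K) m : (0 < m)%N ->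
    (forall i, (i < m)%N -> fcoef b i = 0) -> fcoef b m != 0 ->
  fps_comp a b = 0 -> a = 0.
Proof.
move=> m_gt0 b_small bm_neq0 ab0; apply: fpsP => n; rewrite fcoef0.
elim/ltn_ind: n => n IHn.
have lt_n : (n < (m * n).+1)%N by rewrite ltnS leq_pmull.
have := congr1 (fun c => fcoef c (m * n)) ab0.
rewrite /= (bigD1 (Ordinal lt_n)) //= (fcoefX_order b m n b_small).2.
rewrite big1 => [|k ne_kn].
  by rewrite addr0 => /eqP; rewrite mulf_eq0 expf_eq0 (negPf bm_neq0) andbF orbF
    => /eqP.
have [/IHn ->|le_nk] := ltnP k n; first by rewrite mul0r.
rewrite (fcoefX_order b m k b_small).1 ?mulr0 // ltn_pmul2l //.
by rewrite ltn_neqAle le_nk andbT eq_sym.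
Qed.

(** * The recurrence of the [R_k] and their values as power sums *)

Section PolynomialR.
Context {R : realType}.

(** Brings the even [R_k], built from [T], and the odd ones, built from [U], to a single
    sequence. *)
Lemma chebT_chebU n : chebT R n = chebU_pred R n.+1 - 'X * chebU_pred R n.
Proof.
suff [] : chebT R n = chebU_pred R n.+1 - 'X * chebU_pred R n /\
    chebT R n.+1 = chebU_pred R n.+2 - 'X * chebU_pred R n.+1 by [].
elim: n => [|n [IHn IHn1]].
  rewrite chebU_predSS /chebT /chebU_pred /=; split; first by ring.
  by rewrite -mul_polyC; ring.
by split=> //; rewrite chebTSS IHn IHn1 !chebU_predSS -!mul_polyC; ring.
Qed.

Lemma half_shift_sqr : 2 *: (half_shift R \Po 'X^2) = 'X^2 + 2 :> {poly R}.
Proof.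
rewrite /half_shift comp_polyZ scalerA divff ?scale1r ?pnatr_eq0 //.
by rewrite comp_polyD comp_polyX comp_polyC polyC_natr.
Qed.

(** Both parities reduce to [chebU_pred] at [(X^2 + 2) / 2], whose recurrence has multiplier
    [X^2 + 2]. The last summand corrects [R_0 = 1], where a Lucas sequence would start with 2. *)
Lemma polyRSS k :
  polyR R k.+2 = 'X * polyR R k.+1 + polyR R k + (k == 0)%:R.
Proof.
set m := half_shift R \Po 'X^2.
have twoE (P : {poly R}) : 2 *: P = 2 * P by rewrite scaler_nat mulr_natl.
have VSS n : chebU_pred R n.+2 \Po m =
    ('X^2 + 2) * (chebU_pred R n.+1 \Po m) - (chebU_pred R n \Po m).
  rewrite chebU_predSS comp_polyB comp_polyM comp_polyZ comp_polyX.
  by rewrite half_shift_sqr.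
have TE n : 2 * (chebT R n \Po m) = 2 * (chebU_pred R n.+1 \Po m)
    - ('X^2 + 2) * (chebU_pred R n \Po m).
  rewrite chebT_chebU comp_polyB comp_polyM comp_polyX -half_shift_sqr twoE.
  by rewrite /m; ring.
have oddE n : polyR R n.*2.+1 =
    'X * ((chebU_pred R n.+1 \Po m) + (chebU_pred R n \Po m)).
  rewrite /polyR /= odd_double uphalf_double /Defs.polyP comp_polyD.
  by rewrite -!comp_polyA.
have evenE n : polyR R n.*2 + (n == 0)%:R = 2 * (chebT R n \Po m).
  rewrite /polyR odd_double doubleK /polyQ; case: n => [|n].
    by rewrite /chebT /= !comp_polyC /=; ring.
  by rewrite addr0 comp_polyZ -comp_polyA twoE.
have evenSE n : polyR R n.*2.+2 = 2 * (chebT R n.+1 \Po m).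
  by rewrite -doubleS -evenE addr0.
rewrite -(odd_double_half k); case: (odd k); rewrite ?add1n ?add0n.
  by rewrite addr0 -doubleS oddE doubleS evenSE oddE TE VSS; ring.
by rewrite double_eq0 -addrA evenE evenSE oddE !TE VSS; ring.
Qed.

(* The parity of [k] plays no role here: [half_polyR k] is additive in the
   polynomial [polyR R k], and the two shifts below hold for any polynomial. *)
Definition half_lift k (r : {poly R}) : {poly {poly R}} :=
  \sum_(j < size r) (r`_j *: 'X^((k + j)./2)) *: (- 'X) ^+ j.

Lemma half_lift_wide N k (r : {poly R}) : (size r <= N)%N ->
  half_lift k r = \sum_(j < N) (r`_j *: 'X^((k + j)./2)) *: (- 'X) ^+ j.
Proof.
move=> le_rN; rewrite -(subnKC le_rN) big_split_ord /= [X in _ + X]big1 ?addr0 //.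
by move=> j _; rewrite nth_default ?leq_addr // !scale0r.
Qed.

Lemma half_liftD k r s : half_lift k (r + s) = half_lift k r + half_lift k s.
Proof.
pose N := maxn (size r) (size s).
rewrite !(half_lift_wide N) ?leq_maxl ?leq_maxr ?size_polyD //.
by rewrite -big_split; apply: eq_bigr => j _; rewrite coefD !scalerDl.
Qed.

Lemma half_liftSS k r : half_lift k.+2 r = 'X *: half_lift k r.
Proof.
rewrite /half_lift scaler_sumr; apply: eq_bigr => j _.
by rewrite scalerA -scalerAr -exprS.
Qed.

(** The monomial [x^j] moves to [x^(j+1)], which adds a factor [- y], and the half-exponent
    [(k + 2 + (j + 1)) / 2] exceeds [(k + 1 + j) / 2] by one. *)
Lemma half_liftX k r :
  half_lift k.+2 ('X * r) = 'X *: (- 'X * half_lift k.+1 r).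
Proof.
rewrite (half_lift_wide (size r).+1); last first.
  by rewrite (leq_trans (size_polyMleq _ _)) // size_polyX.
rewrite big_ord_recl /= coefXM !scale0r add0r mulr_sumr scaler_sumr.
apply: eq_bigr => j _; rewrite coefXM /= addnS.
by rewrite -scalerAr scalerA -scalerAr -!exprS.
Qed.

Lemma half_polyRSS k : half_polyR R k.+2 =
  'X *: (half_polyR R k + (k == 0)%:R - 'X * half_polyR R k.+1).
Proof.
have liftE i : half_polyR R i = half_lift i (polyR R i) by [].
rewrite !liftE polyRSS.
rewrite !half_liftD half_liftX half_liftSS.
have -> : half_lift k.+2 (k == 0)%:R = 'X *: (k == 0)%:R.
  case: (k == 0) / eqP => [->|_]; last first.
    by rewrite /half_lift size_poly0 big_ord0 scaler0.
  by rewrite half_liftSS /half_lift size_poly1 big_ord1 coef1 !scale1r.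
by rewrite -!scalerDr; congr (_ *: _); ring.
Qed.

Lemma half_polyR0 : half_polyR R 0 = 1.
Proof.
rewrite /half_polyR /polyR /= comp_polyC size_poly1 big_ord1.
by rewrite coef1 !scale1r.
Qed.

Lemma half_polyR1 : half_polyR R 1 = - ('X *: 'X).
Proof.
have R1 : polyR R 1 = 'X.
  rewrite /polyR /= /Defs.polyP /chebU /chebU_pred /=.
  by rewrite !(comp_polyC, comp_poly0, addr0) mulr1.
rewrite /half_polyR R1 size_polyX !big_ord_recl big_ord0 !coefX /=.
by rewrite !scale0r add0r addr0 scale1r expr1 scalerN.
Qed.

(** Under [Phi], [half_polyRSS] becomes the Newton recurrence [s_(k+2) = (u + v) s_(k+1) - u v s_k],
    with [s_0 = 2] restored by the correction at [k = 0]. *)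
Lemma half_polyR_power_sum (A : comNzRingType)
    (Phi : {rmorphism {poly {poly R}} -> A}) (u v : A) :
    Phi 'X%:P = - (u * v) -> - (Phi 'X%:P * Phi 'X) = u + v ->
  forall k, Phi (half_polyR R k) = if k is 0 then 1 else u ^+ k + v ^+ k.
Proof.
move=> uvE uDvE.
suff E k : Phi (half_polyR R k) + (k == 0)%:R = u ^+ k + v ^+ k.
  case=> [|k]; first by rewrite half_polyR0 rmorph1.
  by rewrite -E addr0.
suff [] : Phi (half_polyR R k) + (k == 0)%:R = u ^+ k + v ^+ k /\
  Phi (half_polyR R k.+1) = u ^+ k.+1 + v ^+ k.+1 by [].
elim: k => [|k [IHk IHk1]].
  rewrite half_polyR0 half_polyR1 rmorph1 -mul_polyC rmorphN rmorphM /= uDvE.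
  by rewrite !expr1.
split; first by rewrite IHk1 addr0.
rewrite half_polyRSS -mul_polyC rmorphM rmorphB rmorphD rmorphM /= rmorph_nat.
rewrite IHk mulrBr mulrA IHk1 -mulNr uDvE uvE !exprS; ring.
Qed.

End PolynomialR.

(** * Regrouping a symmetric double sum by minimum and difference of the indices *)

Section DoubleSum.
Context {A : comNzRingType}.

Lemma sum_ord_shift (F : nat -> A) N i : (i < N)%N ->
    (forall m, (N <= m)%N -> F m = 0) ->
  \sum_(j < N | (i <= j)%N) F j = \sum_(k < N) F (i + k)%N.
Proof.
move=> lt_iN F0; rewrite -(big_mkord xpredT (fun k => F (i + k)%N)).
rewrite -(big_mkord (leq i) F) -[in LHS](subnKC (ltnW lt_iN)).
rewrite /index_iota subn0 iotaD big_cat /= add0n.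
rewrite big_seq_cond big1 ?add0r; last first.
  by move=> j /andP[]; rewrite mem_iota => /andP[_]; rewrite ltnNge => /negPf ->.
rewrite big_seq_cond (eq_bigl (fun j => j \in iota i (N - i))) -?big_seq; last first.
  by move=> j; rewrite mem_iota; case: (i <= j)%N; rewrite ?andbF ?andbT.
rewrite subn0 -[in RHS](subnK (ltnW lt_iN)) iotaD big_cat /= add0n.
rewrite [X in _ + X]big_seq [X in _ + X]big1 ?addr0.
  by rewrite -[X in iota X _](addn0 i) iotaDl big_map.
move=> k; rewrite mem_iota => /andP[le_k _].
by rewrite F0 // -leq_subLR.
Qed.

(** The pairs [(n, n + k)] and [(n + k, n)] together give [u^k + v^k]; for [k = 0] they coincide,
    hence the value 1. *)
Lemma sum_mul_sum_symmetric (c : nat -> A) (u v : A) N :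
    (forall m, (N <= m)%N -> c m = 0) ->
  (\sum_(i < N) c i * u ^+ i) * (\sum_(j < N) c j * v ^+ j) =
  \sum_(n < N) \sum_(k < N) c n * c (n + k)%N * (u * v) ^+ n *
     (if k : nat is 0 then 1 else u ^+ k + v ^+ k).
Proof.
move=> c0; pose G i j := c i * u ^+ i * (c j * v ^+ j).
have G0r i m : (N <= m)%N -> G i m = 0.
  by move=> /c0 cm0; rewrite /G cm0 mul0r mulr0.
have G0l i m : (N <= m)%N -> G m i = 0.
  by move=> /c0 cm0; rewrite /G cm0 !mul0r.
rewrite big_distrlr /=.
transitivity (\sum_(i < N) \sum_(j < N | (i <= j)%N) G i j +
              \sum_(i < N) \sum_(j < N | ~~ (i <= j)%N) G i j).
  rewrite -big_split; apply: eq_bigr => i _ /=.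
  by rewrite (bigID (fun j : 'I_N => (i <= j)%N)).
(* After the exchange the outer index [n] is the smaller one in both halves. *)
rewrite [X in _ + X](exchange_big_dep xpredT) //= -big_split; apply: eq_bigr => n _ /=.
rewrite (sum_ord_shift (G n)) //; last exact: G0r.
have -> : \sum_(i < N | ~~ (i <= n)%N) G i n =
    \sum_(k < N | k != 0 :> nat) G (n + k)%N n.
  (* Adding the diagonal term turns the strict range into the one handled by [sum_ord_shift]. *)
  apply: (addrI (G n n)).
  have := sum_ord_shift (G^~ n) _ _ (ltn_ord n) (G0l n).
  rewrite (bigD1 n) //= => E; rewrite -[RHS]addrC.
  transitivity (\sum_(k < N) G (n + k)%N n).
    rewrite -E; congr (_ + _); apply: eq_bigl => i.
    by rewrite -ltnNge ltn_neqAle andbC eq_sym.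
  have N_gt0 : (0 < N)%N by apply: leq_ltn_trans (ltn_ord n).
  rewrite (bigD1 (Ordinal N_gt0)) //= addn0 addrC.
  by congr (_ + _); apply: eq_bigl => k; rewrite -val_eqE.
rewrite [X in _ + X]big_mkcond -big_split; apply: eq_bigr => -[[|k] lt_k] _ /=.
  by rewrite /G addn0 exprMn; ring.
by rewrite /G exprMn !exprD; ring.
Qed.

End DoubleSum.

Theorem theorem6p2 (R : realType) (p q : {poly R}) (g f B : fps R)
    (hp : p.[0] = 1) (hq : q.[0] = 1)
    (hg : g = fps_of_poly p / fps_of_poly q)
    (hgf : pseudo_involutory_companion g f)
    (hf : f <> - fpsX R)
    (hB : is_B_function f B) :
  is_series_solution (Bfun_poly p q) B.
Proof.
have [[_ /= f0 f1] /(congr1 fst) ginv] := hgf.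
set z := fpsX R; set h := - f; set t := z * f.
have h0 : fcoef h 0 = 0 by rewrite fcoefN f0 oppr0.
have z0 : fcoef z 0 = 0 by rewrite /= coefX.
have t0 : fcoef t 0 = 0 by rewrite fcoefM big_ord1 z0 mul0r.
have t1 : fcoef t 1 = 0.
  by rewrite fcoefM !big_ord_recl big_ord0 z0 /= f0 mul0r mulr0 !addr0.
(* This coefficient is [fcoef f 1]. *)
have t2 : fcoef t 2 != 0.
  rewrite fcoefM !big_ord_recl big_ord0 z0 /= /bump /= !coefX /= f0.
  by rewrite !mul0r mul1r !addr0 add0r.
pose C : {rmorphism R -> fps R} := @fps_of_poly R \o polyC.
(* From [p = g q], the left side is [g (g \o h)] times the right side, and [g (g \o h) = 1] by
   [ginv]. *)
have pqE : (map_poly C p).[z] * (map_poly C p).[h] =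
           (map_poly C q).[z] * (map_poly C q).[h].
  have evz (P : {poly R}) : (map_poly C P).[z] = fps_of_poly P.
    rewrite -fps_comp_poly //; apply: fpsP => n /=.
    rewrite (bigD1 ord_max) //= -rmorphXn /= coefXn eqxx mulr1.
    rewrite big1 ?addr0 // => k ne_kn.
    rewrite -rmorphXn /= coefXn; case: eqP => [E|_]; last by rewrite mulr0.
    by case/eqP: ne_kn; apply: val_inj.
  have Uq : fps_of_poly q \is a GRing.unit.
    by rewrite unfold_in /= /fps_unit inE /= -horner_coef0 hq unitr1.
  have pE : fps_of_poly p = g * fps_of_poly q by rewrite hg divrK.
  rewrite !evz -!fps_comp_poly // pE fps_compM //.
  have gh1 : g * fps_comp g h = 1 by apply: ginv.
  by rewrite mulrACA gh1 mul1r.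
(* [phi] evaluates at [(z, B)]; followed by composition with [t], it gives the evaluation [Phi] at
   [(t, B(t))]. *)
pose phi : {rmorphism {poly {poly R}} -> fps R} :=
  horner_eval B \o map_poly (@fps_of_poly R).
pose psi a := fps_comp a t.
have psiB : zmod_morphism psi by move=> a b; apply: fps_compB.
have psiM : monoid_morphism psi.
  by split=> [|a b]; [apply: fps_comp1 | apply: fps_compM].
pose psiZ := GRing.isZmodMorphism.Build _ _ psi psiB.
pose psiR := GRing.isMonoidMorphism.Build _ _ psi psiM.
pose psiH : {rmorphism fps R -> fps R} := HB.pack psi psiZ psiR.
pose Phi : {rmorphism {poly {poly R}} -> fps R} := psiH \o phi.
have PhiX : Phi 'X%:P = t.
  by rewrite /= /horner_eval map_polyC hornerC; apply: fps_compX.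
have PhiC x : Phi x%:P%:P = C x.
  by rewrite /= /horner_eval map_polyC hornerC; apply: fps_compC.
have PhiY : Phi 'X = fps_comp B t by rewrite /= /horner_eval map_polyX hornerX.
have zhE : z * h = - t by rewrite /h mulrN.
have PhiR : forall k,
    Phi (half_polyR R k) = if k is 0 then 1 else z ^+ k + h ^+ k.
  apply: half_polyR_power_sum; first by rewrite PhiX zhE opprK.
  by rewrite PhiX PhiY -hB opprB.
suff : Phi (Bfun_poly p q) = 0.
  apply: (fps_comp_eq0 _ _ _ 2) => //.
  by case=> [|[|i]].
pose N := maxn (size p) (size q).
have evN (P : {poly R}) x : (size P <= N)%N ->
    (map_poly C P).[x] = \sum_(i < N) C P`_i * x ^+ i.
  move=> le_PN; rewrite (@horner_coef_wide _ N); last first.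
    by rewrite (leq_trans (size_poly _ _)).
  by apply: eq_bigr => i _; rewrite coef_map.
have C0 (P : {poly R}) : (size P <= N)%N -> forall m, (N <= m)%N -> C P`_m = 0.
  move=> le_PN m le_Nm; rewrite nth_default ?rmorph0 //.
  exact: leq_trans le_Nm.
have le_pN : (size p <= N)%N by apply: leq_maxl.
have le_qN : (size q <= N)%N by apply: leq_maxr.
move: pqE; rewrite !evN //.
rewrite (sum_mul_sum_symmetric (fun i => C p`_i)) ?(C0 p) //; last exact: C0.
rewrite (sum_mul_sum_symmetric (fun i => C q`_i)); last exact: C0.
move/eqP; rewrite -subr_eq0 -sumrB => /eqP <-.
rewrite /Bfun_poly -/N rmorph_sum; apply: eq_bigr => n _.
rewrite rmorph_sum -sumrB; apply: eq_bigr => k _.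
rewrite -!mul_polyC rmorphM polyCM rmorphM PhiC.
rewrite PhiR polyC_exp rmorphXn PhiX zhE.
(* The sign [(-1)^n] of the equation is the one in [(z h)^n = (- t)^n]. *)
rewrite !rmorphM rmorphB !rmorphM rmorphXn rmorphN1 [(- t) ^+ n]exprNn.
by set s := (-1) ^+ n; set E := if _ is 0 then _ else _; ring.
Qed.
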